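(* Let $G$ be a countable group and $H$ a normal subgroup of $G$. If $H$ is linear sofic and $G/H$ is amenable, then $G$ is linear sofic.
   Context: A countable group is linear sofic if it admits an injective group morphism into $\prod_{k\to\omega}GL_{n_k}(\mathbb{C})/d_\omega$ for some non-principal ultrafilter $\omega$ on $\mathbb{N}$ and $n_k\to\infty$, where this is the quotient of $\prod_kGL_{n_k}(\mathbb{C})$ by $\{(a_k)_k:\lim_{k\to\omega}\rho(a_k-\mathrm{Id})=0\}$ and $\rho(a)=\operatorname{rk}(a)/n$ for $a\in M_n(\mathbb{C})$. *)

(* Defs.v *)
From HB Require Import structures.
From Stdlib Require Import Reals Lra ClassicalEpsilon FunctionalExtensionality PropExtensionality ProofIrrelevance.
From mathcomp Require Import all_boot all_algebra.
Set Implicit Arguments. Unset Strict Implicit. Unset Printing Implicit Defensive.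

Record complex := Cplx { Cre : R; Cim : R }.

Definition complex_eqb (x y : complex) : bool :=
  if excluded_middle_informative (x = y) then true else false.
Lemma complex_eqP : Equality.axiom complex_eqb.
Proof. move=> x y; rewrite /complex_eqb; case: excluded_middle_informative => h; by constructor. Qed.
HB.instance Definition _ := hasDecEq.Build complex complex_eqP.

Definition complex_find (P : pred complex) (n : nat) : option complex :=
  match excluded_middle_informative (exists x, P x) with
  | left h => Some (proj1_sig (constructive_indefinite_description _ h))
  | right _ => None end.
Lemma complex_find_correct P n x : complex_find P n = Some x -> P x.
Proof. rewrite /complex_find; case: excluded_middle_informative => // h [<-].
 exact: proj2_sig (constructive_indefinite_description _ h). Qed.
Lemma complex_find_complete (P : pred complex) : (exists x, P x) -> exists n, complex_find P n.
Proof. move=> h; exists 0%N; rewrite /complex_find; case: excluded_middle_informative => //. Qed.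
Lemma complex_find_ext (P Q : pred complex) : P =1 Q -> complex_find P =1 complex_find Q.
Proof. move=> e n; have -> : P = Q by apply: functional_extensionality. by []. Qed.
HB.instance Definition _ := hasChoice.Build complex complex_find_correct complex_find_complete complex_find_ext.

Local Open Scope R_scope.
Definition Cadd (x y : complex) := Cplx (Cre x + Cre y) (Cim x + Cim y).
Definition Copp (x : complex) := Cplx (- Cre x) (- Cim x).
Definition Czero := Cplx 0 0.
Definition Cone := Cplx 1 0.
Definition Cmul (x y : complex) := Cplx (Cre x * Cre y - Cim x * Cim y) (Cre x * Cim y + Cim x * Cre y).
Definition Cinv (x : complex) :=
  let d := Cre x * Cre x + Cim x * Cim x in Cplx (Cre x / d) (- Cim x / d).

Lemma ceq a b c d : a = c -> b = d -> Cplx a b = Cplx c d. Proof. by move=> -> ->. Qed.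
Lemma Cadd_assoc : associative Cadd. Proof. move=> [a b] [c d] [e f]; apply: ceq => /=; ring. Qed.
Lemma Cadd_comm : commutative Cadd. Proof. move=> [a b] [c d]; apply: ceq => /=; ring. Qed.
Lemma Cadd0 : left_id Czero Cadd. Proof. move=> [a b]; apply: ceq => /=; ring. Qed.
Lemma CaddN : left_inverse Czero Copp Cadd. Proof. move=> [a b]; apply: ceq => /=; ring. Qed.
HB.instance Definition _ := GRing.isZmodule.Build complex Cadd_assoc Cadd_comm Cadd0 CaddN.
Lemma Cmul_assoc : associative Cmul. Proof. move=> [a b] [c d] [e f]; apply: ceq => /=; ring. Qed.
Lemma Cmul_comm : commutative Cmul. Proof. move=> [a b] [c d]; apply: ceq => /=; ring. Qed.
Lemma Cmul1 : left_id Cone Cmul. Proof. move=> [a b]; apply: ceq => /=; ring. Qed.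
Lemma CmulDl : left_distributive Cmul Cadd. Proof. move=> [a b] [c d] [e f]; apply: ceq => /=; ring. Qed.
Lemma Cone_neq0 : Cone != Czero.
Proof. apply/eqP => -[]; lra. Qed.
HB.instance Definition _ := GRing.Zmodule_isComNzRing.Build complex Cmul_assoc Cmul_comm Cmul1 CmulDl Cone_neq0.
Lemma CmulV (x : complex) : x != 0%R -> Cmul (Cinv x) x = Cone.
Proof.
move: x => [a b] /eqP nz.
have hd : a * a + b * b <> 0.
  move=> h; apply: nz; have ha : a = 0 by nra. have hb : b = 0 by nra.
  by rewrite ha hb.
apply: ceq => /=; field; exact hd.
Qed.
Lemma Cinv0 : Cinv 0%R = 0%R.
Proof. rewrite /Cinv /=; apply: ceq => /=; rewrite /Rdiv; ring. Qed.
HB.instance Definition _ := GRing.ComNzRing_isField.Build complex CmulV Cinv0.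
Close Scope R_scope.

Record group := Group {
  gcar :> Type;
  gmul : gcar -> gcar -> gcar;
  ginv : gcar -> gcar;
  gone : gcar;
  gmulA : forall x y z, gmul x (gmul y z) = gmul (gmul x y) z;
  gmul1 : forall x, gmul gone x = x;
  gmulV : forall x, gmul (ginv x) x = gone }.
Arguments gmul {g}. Arguments ginv {g}. Arguments gone {g}.

Section GroupFacts.
Variable G : group.
Lemma gmulVr (x : G) : gmul x (ginv x) = gone.
Proof.
have e : gmul x (ginv x) = gmul (gmul (ginv (ginv x)) (ginv x)) (gmul x (ginv x)).
  by rewrite gmulV gmul1.
rewrite e -gmulA (gmulA (ginv x)) gmulV gmul1; exact: gmulV.
Qed.
Lemma gmulr1 (x : G) : gmul x gone = x.
Proof. by rewrite -(gmulV x) gmulA gmulVr gmul1. Qed.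
Lemma ginv_uniq (a b : G) : gmul a b = gone -> ginv b = a.
Proof. by move=> e; rewrite -(gmul1 (ginv b)) -e -gmulA gmulVr gmulr1. Qed.
Lemma ginvK (x : G) : ginv (ginv x) = x.
Proof. apply: ginv_uniq; exact: gmulVr. Qed.
Lemma ginvM (x y : G) : ginv (gmul x y) = gmul (ginv y) (ginv x).
Proof.
apply: ginv_uniq; by rewrite -gmulA (gmulA (ginv x)) gmulV gmul1 gmulV.
Qed.
End GroupFacts.

Definition countable_group (G : group) : Prop :=
  exists f : G -> nat, forall x y, f x = f y -> x = y.

Record normal_subgroup (G : group) (H : G -> Prop) : Prop := NormalSubgroup {
  ns_one : H gone;
  ns_mul : forall x y, H x -> H y -> H (gmul x y);
  ns_inv : forall x, H x -> H (ginv x);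
  ns_conj : forall g x, H x -> H (gmul g (gmul x (ginv g))) }.
Arguments normal_subgroup : clear implicits.

Section SubGroup.
Variables (G : group) (H : G -> Prop) (hH : normal_subgroup G H).
Definition sg_car := {x : G | H x}.
Definition sg_mul (x y : sg_car) : sg_car :=
  exist _ (gmul (proj1_sig x) (proj1_sig y)) (ns_mul hH (proj2_sig x) (proj2_sig y)).
Definition sg_inv (x : sg_car) : sg_car := exist _ (ginv (proj1_sig x)) (ns_inv hH (proj2_sig x)).
Definition sg_one : sg_car := exist _ gone (ns_one hH).
Lemma sg_eq (x y : sg_car) : proj1_sig x = proj1_sig y -> x = y.
Proof.
move: x y => [x hx] [y hy] /= e; subst y; f_equal; exact: proof_irrelevance.
Qed.
Lemma sg_mulA x y z : sg_mul x (sg_mul y z) = sg_mul (sg_mul x y) z.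
Proof. apply: sg_eq; exact: gmulA. Qed.
Lemma sg_mul1 x : sg_mul sg_one x = x.
Proof. apply: sg_eq; exact: gmul1. Qed.
Lemma sg_mulV x : sg_mul (sg_inv x) x = sg_one.
Proof. apply: sg_eq; exact: gmulV. Qed.
Definition subgroup_group : group := Group sg_mulA sg_mul1 sg_mulV.
End SubGroup.

Section Quotient.
Variables (G : group) (H : G -> Prop) (hH : normal_subgroup G H).
Definition coset (g : G) : G -> Prop := fun x => H (gmul (ginv g) x).
Definition qcar := {S : G -> Prop | exists g, S = coset g}.
Definition qrep (S : qcar) : G := proj1_sig (constructive_indefinite_description _ (proj2_sig S)).
Lemma qrepE (S : qcar) : coset (qrep S) = proj1_sig S.
Proof. rewrite /qrep; case: constructive_indefinite_description => g /= ->; done. Qed.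
Definition qclass (g : G) : qcar := exist _ (coset g) (ex_intro _ g erefl).
Definition qmul (S T : qcar) : qcar := qclass (gmul (qrep S) (qrep T)).
Definition qinv (S : qcar) : qcar := qclass (ginv (qrep S)).
Definition qone : qcar := qclass gone.

Lemma q_eq (S T : qcar) : proj1_sig S = proj1_sig T -> S = T.
Proof. move: S T => [S hS] [T hT] /= e; subst T; f_equal; exact: proof_irrelevance. Qed.
Lemma coset_eqP (a b : G) : coset a = coset b <-> H (gmul (ginv a) b).
Proof.
split.
  move=> e; have : coset b b by rewrite /coset gmulV; exact: ns_one hH.
  by rewrite -e.
move=> h; apply: functional_extensionality => x; apply: propositional_extensionality.
rewrite /coset; split => hx.
  have := ns_mul hH (ns_inv hH h) hx.
  by rewrite ginvM ginvK gmulA -(gmulA _ a) gmulVr gmulr1.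
have := ns_mul hH h hx.
by rewrite gmulA -(gmulA _ b) gmulVr gmulr1.
Qed.
Lemma qclass_rep (S : qcar) : qclass (qrep S) = S.
Proof. apply: q_eq; exact: qrepE. Qed.
Lemma coset_mul a a' b b' : coset a = coset a' -> coset b = coset b' ->
  coset (gmul a b) = coset (gmul a' b').
Proof.
move=> /coset_eqP ha /coset_eqP hb; apply/coset_eqP.
rewrite ginvM.
have e : gmul (gmul (ginv b) (ginv a)) (gmul a' b') =
         gmul (gmul (ginv b) (gmul (gmul (ginv a) a') (ginv (ginv b))))
              (gmul (ginv b) b').
  by rewrite ginvK -!gmulA (gmulA b) gmulVr gmul1.
rewrite e; apply: (ns_mul hH) => //; exact: (ns_conj hH).
Qed.
Lemma qrep_class g : coset (qrep (qclass g)) = coset g.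
Proof. by rewrite qrepE. Qed.
Lemma q_mulA x y z : qmul x (qmul y z) = qmul (qmul x y) z.
Proof.
apply: q_eq => /=.
have -> : coset (gmul (qrep x) (qrep (qmul y z))) =
          coset (gmul (qrep x) (gmul (qrep y) (qrep z))).
  by apply: coset_mul; rewrite ?qrep_class.
have -> : coset (gmul (qrep (qmul x y)) (qrep z)) =
          coset (gmul (gmul (qrep x) (qrep y)) (qrep z)).
  by apply: coset_mul; rewrite ?qrep_class.
by rewrite gmulA.
Qed.
Lemma q_mul1 x : qmul qone x = x.
Proof.
apply: q_eq => /=; rewrite -qrepE; apply: (@eq_trans _ _ (coset (gmul gone (qrep x)))).
  by apply: coset_mul; rewrite ?qrep_class.
by rewrite gmul1.
Qed.
Lemma q_mulV x : qmul (qinv x) x = qone.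
Proof.
apply: q_eq => /=; apply: (@eq_trans _ _ (coset (gmul (ginv (qrep x)) (qrep x)))).
  by apply: coset_mul; rewrite ?qrep_class.
by rewrite gmulV.
Qed.
Definition quotient_group : group := Group q_mulA q_mul1 q_mulV.
End Quotient.

Open Scope R_scope.
Definition amenable (G : group) : Prop :=
  exists m : (G -> Prop) -> R,
    m (fun _ => True) = 1 /\
    (forall A, 0 <= m A) /\
    (forall A B, (forall x, A x -> B x -> False) ->
        m (fun x => A x \/ B x) = m A + m B) /\
    (forall (g : G) A, m (fun x => A (gmul (ginv g) x)) = m A).

Record ultrafilter (U : (nat -> Prop) -> Prop) : Prop := Ultrafilter {
  uf_full : U (fun _ => True);
  uf_proper : ~ U (fun _ => False);
  uf_up : forall A B : nat -> Prop, (forall k, A k -> B k) -> U A -> U B;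
  uf_cap : forall A B, U A -> U B -> U (fun k => A k /\ B k);
  uf_ultra : forall A, U A \/ U (fun k => ~ A k) }.

Definition nonprincipal (U : (nat -> Prop) -> Prop) : Prop :=
  forall m : nat, ~ U (fun k => k = m).

Definition ulim_zero (U : (nat -> Prop) -> Prop) (u : nat -> R) : Prop :=
  forall eps : R, 0 < eps -> U (fun k => Rabs (u k) < eps).

Definition rho (n : nat) (A : 'M[complex]_n) : R := INR (\rank A) / INR n.

(* (a_k) and (b_k) in prod_k GL_{n_k}(C) have the same image in the quotient
   by N = {(c_k) : lim_{k->U} rho(c_k - Id) = 0}, i.e. a b^{-1} \in N. *)
Close Scope R_scope.
Local Open Scope ring_scope.
Definition mx_defect (n : nat) (a b : 'M[complex]_n) : 'M[complex]_n :=
  a *m invmx b - 1%:M.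

Definition ueq (U : (nat -> Prop) -> Prop) (n : nat -> nat)
  (a b : forall k, 'M[complex]_(n k)) : Prop :=
  ulim_zero U (fun k => rho (mx_defect (a k) (b k))).
Arguments ueq : clear implicits.

(* G admits an injective group morphism into prod_{k->U} GL_{n_k}(C)/d_U,
   for some nonprincipal ultrafilter U and n_k -> infinity.  The morphism is
   given by a (pointwise invertible) lift f : G -> prod_k GL_{n_k}(C). *)
Definition linear_sofic (G : group) : Prop :=
  countable_group G /\
  exists (U : (nat -> Prop) -> Prop) (n : nat -> nat)
         (f : G -> forall k, 'M[complex]_(n k)),
    ultrafilter U /\ nonprincipal U /\
    (forall N : nat, exists K : nat, forall k, (K <= k)%N -> (N <= n k)%N) /\
    (forall g k, f g k \in unitmx) /\
    (forall g h, ueq U n (f (gmul g h)) (fun k => f g k *m f h k)) /\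
    (forall g h, ueq U n (f g) (f h) -> g = h).

(* Main.v *)
(** Amplification.  Suppose A and B have normalized rank distance a and b from the identity.
    Then A (x) B has distance at least a + b - 2ab, as for independent coin flips.  Replacing an
    approximate representation f by (f + 1), whose distances are at most 1/2, and taking tensor
    powers therefore separates any finite set of nontrivial elements of H by the uniform
    amount 1/4.  This uniformity is what makes induction work: an element g of H acts
    on the induced representation through all its conjugates at once.

    Induction.  If some finite subset of G / H doubled all finite sets, Hall's theorem and a limit along the
    ultrafilter would give a paradoxical decomposition, contradicting the invariant mean; so
    G / H has Folner sets F.  The representation of H is induced to the blocks indexed by F,
    with an error on the boundary of F only.  Elements of H act block-diagonally, the others
    move every block, and both stay at distance at least 1/4 from the identity.  The resulting
    matrices are finally perturbed to invertible ones, at a cost in rank equal to their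
    corank. *)

From HB Require Import structures.
From Stdlib Require Import Reals Lra.
From mathcomp Require Import all_boot all_algebra.
From mathcomp Require Import zify boolp.
Require Import Defs.
Set Implicit Arguments. Unset Strict Implicit. Unset Printing Implicit Defensive.
Import GRing.Theory.
Local Open Scope ring_scope.

(** * Ranks of tensor products of matrices *)

(** The Kronecker product, encoded as the map [Z |-> A^T Z B] on matrices flattened by [mxvec], so
    that identities can be checked on [Z]. *)
Definition tensmx (F : fieldType) m m' n n' (A : 'M[F]_(m, m')) (B : 'M[F]_(n, n')) :
    'M[F]_(m * n, m' * n') :=
  lin_mx (mulmxr B \o mulmx A^T).

Lemma mxvec_tensmx (F : fieldType) m m' n n' (A : 'M[F]_(m, m')) (B : 'M[F]_(n, n')) Z :
  mxvec Z *m tensmx A B = mxvec (A^T *m Z *m B).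
Proof. by rewrite mul_vec_lin. Qed.

Lemma eq_mulmx_mxvec (F : fieldType) m n p (A B : 'M[F]_(m * n, p)) :
  (forall Z : 'M_(m, n), mxvec Z *m A = mxvec Z *m B) -> A = B.
Proof. by move=> e; apply/eqP/mulmxP => u; rewrite -(vec_mxK u). Qed.

Lemma tensmxM (F : fieldType) m m' m'' n n' n'' (A : 'M[F]_(m, m')) (A' : 'M_(m', m''))
    (B : 'M_(n, n')) (B' : 'M_(n', n'')) :
  tensmx A B *m tensmx A' B' = tensmx (A *m A') (B *m B').
Proof.
by apply: eq_mulmx_mxvec => Z; rewrite mulmxA !mxvec_tensmx trmx_mul !mulmxA.
Qed.

Lemma tensmx1 (F : fieldType) m n : tensmx (1%:M : 'M[F]_m) (1%:M : 'M[F]_n) = 1%:M.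
Proof.
by apply: eq_mulmx_mxvec => Z; rewrite mxvec_tensmx trmx1 mul1mx !mulmx1.
Qed.

Lemma tensmxBl (F : fieldType) m m' n n' (A A' : 'M[F]_(m, m')) (B : 'M[F]_(n, n')) :
  tensmx (A - A') B = tensmx A B - tensmx A' B.
Proof.
apply: eq_mulmx_mxvec => Z.
by rewrite mulmxBr !mxvec_tensmx -linearB /= raddfB /= !mulmxBl.
Qed.

Lemma tensmxBr (F : fieldType) m m' n n' (A : 'M[F]_(m, m')) (B B' : 'M[F]_(n, n')) :
  tensmx A (B - B') = tensmx A B - tensmx A B'.
Proof.
apply: eq_mulmx_mxvec => Z.
by rewrite mulmxBr !mxvec_tensmx -linearB /= mulmxBr.
Qed.

(** Rank factorizations of [A] and [B] make the tensor product factor through a matrix with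
    [\rank A * \rank B] rows. *)
Lemma mxrank_tensmx_le (F : fieldType) m m' n n' (A : 'M[F]_(m, m')) (B : 'M[F]_(n, n')) :
  (\rank (tensmx A B) <= \rank A * \rank B)%N.
Proof.
rewrite -{1}(mulmx_base A) -{1}(mulmx_base B) -tensmxM.
exact: leq_trans (mxrankM_maxr _ _) (rank_leq_row _).
Qed.

(** With row bases [P0] and [Q0], such a [Z] has the form [P0^T W Q0]; a right inverse of [Q0]
    provides [W]. The target has [\rank P * \rank Q] rows, so membership gives a dimension bound. *)
Lemma mxvec_sub_tensmx (F : fieldType) p q m n (P : 'M[F]_(p, m)) (Q : 'M[F]_(q, n))
    (Z : 'M[F]_(m, n)) :
  (Z^T <= P)%MS -> (Z <= Q)%MS -> (mxvec Z <= tensmx (row_base P) (row_base Q))%MS.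
Proof.
rewrite -(eq_row_base P) -(eq_row_base Q) => /submxP[X eX] /submxP[Y eY].
have /row_freeP[R eR] := row_base_free Q.
have -> : Z = (row_base P)^T *m (X^T *m R) *m row_base Q.
  rewrite mulmxA -trmx_mul -eX trmxK.
  by rewrite {2}eY -(mulmxA Y) eR mulmx1.
by rewrite -mxvec_tensmx submxMl.
Qed.

(* A fixed point Z = A^T Z B satisfies (A - 1)^T Z B = - Z (B - 1).  Applying Z |-> Z (B - 1)
   lands in a space of dimension at most rk(A - 1) rk(B - 1), while the fixed points killed
   by this map vanish under A - 1 and B - 1 on either side. *)
Lemma mxrank_tensmx_sub1 (F : fieldType) m n (A : 'M[F]_m) (B : 'M[F]_n) :
  (m * n <= \rank (tensmx A B - 1%:M)%R + \rank (A - 1%:M)%R * \rank (B - 1%:M)%R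
            + (m - \rank (A - 1%:M)%R) * (n - \rank (B - 1%:M)%R))%N.
Proof.
set T := tensmx A B - 1%:M; set D := A - 1%:M; set E := B - 1%:M.
suff : (\rank (kermx T) <= \rank D * \rank E + (m - \rank D) * (n - \rank E))%N.
  by rewrite mxrank_ker; have := rank_leq_row T; lia.
have fixT (v : 'rV_(m * n)) : (v <= kermx T)%MS ->
    D^T *m vec_mx v *m B = - (vec_mx v *m E).
  move/sub_kermxP; rewrite -{1}(vec_mxK v) mulmxBr mulmx1 mxvec_tensmx.
  move/eqP; rewrite subr_eq0 => /eqP/(can_inj mxvecK) e.
  by rewrite /D /E raddfB /= trmx1 mulmxBl mul1mx mulmxBl mulmxBr mulmx1 e opprB.
pose L : 'M_(m * n) := lin_mx (mulmxr E).
rewrite -(mxrank_mul_ker (kermx T) L); apply: leq_add.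
  apply: (@leq_trans (\rank (tensmx (row_base D) (row_base E)))); last exact: rank_leq_row.
  apply/mxrankS/row_subP => i; rewrite row_mul; set v := row i _.
  have hv : (v <= kermx T)%MS by exact: row_sub.
  rewrite mul_rV_lin /=; apply: mxvec_sub_tensmx; last exact: submxMl.
  rewrite -[_ *m E]opprK -(fixT _ hv) -mulmxA raddfN /= trmx_mul trmxK.
  by rewrite eqmx_opp submxMl.
rewrite -(mxrank_ker D) -(mxrank_ker E).
apply: (@leq_trans (\rank (tensmx (row_base (kermx D)) (row_base (kermx E)))));
  last exact: rank_leq_row.
apply/mxrankS/row_subP => i; set v := row i _.
have : (v <= kermx T :&: kermx L)%MS by exact: row_sub.
rewrite sub_capmx => /andP[hv /sub_kermxP].
rewrite mul_rV_lin /= -[RHS](linear0 mxvec) => /(can_inj mxvecK) hE.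
rewrite -(vec_mxK v); apply: mxvec_sub_tensmx; last exact/sub_kermxP.
have eB : vec_mx v *m B = vec_mx v.
  by apply/eqP; rewrite -subr_eq0 -{2}(mulmx1 (vec_mx v)) -mulmxBr hE.
apply/sub_kermxP; rewrite -[X in _ *m X]trmxK -trmx_mul -eB mulmxA.
by rewrite fixT // hE oppr0 trmx0.
Qed.

(** Write [A] as unit, partial identity, unit, and replace the partial identity by the identity. *)
Lemma exists_unitmx_rank_sub (F : fieldType) n (A : 'M[F]_n) :
  exists2 B, B \in unitmx & \rank (A - B) = (n - \rank A)%N.
Proof.
exists (col_ebase A *m row_ebase A).
  by rewrite unitmx_mul col_ebase_unit row_ebase_unit.
rewrite -{1}(mulmx_ebase A) -{2}(mulmx1 (col_ebase A)) -mulmxBl -mulmxBr.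
rewrite -mxrank_opp -mulNmx -mulmxN opprB.
rewrite mxrankMfree ?row_free_unit ?row_ebase_unit //.
rewrite -mxrank_tr trmx_mul mxrankMfree ?row_free_unit ?unitmx_tr ?col_ebase_unit //.
by rewrite mxrank_tr rank_copid_mx // rank_leq_row.
Qed.

(* Normalized rank and the distance it defines *)
Delimit Scope R_scope with Re.
Arguments rho {n} A%_ring_scope.

Lemma rho_ge0 n (A : 'M[complex]_n) : (0 <= rho A)%Re.
Proof.
(* In size 0 the quotient is 0 because [/ 0 = 0]. *)
rewrite /rho; case: n A => [|n] A; first by rewrite [INR 0]/= /Rdiv Rinv_0 Rmult_0_r; lra.
apply: Rmult_le_pos; first exact: pos_INR.
by apply/Rlt_le/Rinv_0_lt_compat/lt_0_INR/ltP.
Qed.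

Lemma rho_le n m (A : 'M[complex]_n) (B : 'M[complex]_m) :
  (\rank A * m <= \rank B * n)%N -> (0 < m)%N -> (rho A <= rho B)%Re.
Proof.
move=> h m0; rewrite /rho; case: n A h => [|n] A h.
  rewrite [INR 0]/= {1}/Rdiv Rinv_0 Rmult_0_r; exact: (rho_ge0 B).
have mp : (0 < INR m)%Re by apply/lt_0_INR/ltP.
have np : (0 < INR n.+1)%Re by apply/lt_0_INR/ltP.
apply: (Rmult_le_reg_r (INR m * INR n.+1)%Re); first nra.
have -> : (INR (\rank A) / INR n.+1 * (INR m * INR n.+1) = INR (\rank A) * INR m)%Re.
  by field; lra.
have -> : (INR (\rank B) / INR m * (INR m * INR n.+1) = INR (\rank B) * INR n.+1)%Re.
  by field; lra.
by rewrite -!mult_INR; apply/le_INR/leP; rewrite !multE.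
Qed.

Lemma rho_le1 n (A : 'M[complex]_n) : (rho A <= 1)%Re.
Proof.
case: n A => [|n] A; first by rewrite /rho [INR 0]/= /Rdiv Rinv_0 Rmult_0_r; lra.
have np : (0 < INR n.+1)%Re by apply/lt_0_INR/ltP.
rewrite /rho; apply: (Rmult_le_reg_r (INR n.+1)) => //.
rewrite /Rdiv Rmult_assoc Rinv_l ?Rmult_1_r ?Rmult_1_l; last lra.
exact/le_INR/leP/rank_leq_row.
Qed.

Lemma rho_0 n : rho (0 : 'M[complex]_n) = 0%Re.
Proof. by rewrite /rho mxrank0 /= /Rdiv Rmult_0_l. Qed.

Lemma rho_1 n : (0 < n)%N -> rho (1%:M : 'M[complex]_n) = 1%Re.
Proof.
move=> n0; rewrite /rho mxrank1 /Rdiv Rinv_r //.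
by apply/Rgt_not_eq/lt_0_INR/ltP.
Qed.

Lemma rhoD n (A B : 'M[complex]_n) : (rho (A + B) <= rho A + rho B)%Re.
Proof.
case: n A B => [|n] A B.
  by rewrite [A]flatmx0 [B]flatmx0 addr0 rho_0; lra.
have np : (0 < INR n.+1)%Re by apply/lt_0_INR/ltP.
rewrite /rho /Rdiv -Rmult_plus_distr_r -plus_INR; apply: Rmult_le_compat_r.
  exact/Rlt_le/Rinv_0_lt_compat.
by apply/le_INR/leP; exact: mxrank_add.
Qed.

Lemma rhoN n (A : 'M[complex]_n) : rho (- A) = rho A.
Proof. by rewrite /rho mxrank_opp. Qed.

Lemma rho_distC n (A B : 'M[complex]_n) : rho (A - B) = rho (B - A).
Proof. by rewrite -rhoN opprB. Qed.

Lemma rho_triangle n (B A C : 'M[complex]_n) :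
  (rho (A - C) <= rho (A - B) + rho (B - C))%Re.
Proof. by have := rhoD (A - B) (B - C); rewrite addrA subrK. Qed.

Lemma rho_le_same n (A B : 'M[complex]_n) : (\rank A <= \rank B)%N -> (rho A <= rho B)%Re.
Proof.
case: n A B => [|n] A B h; first by rewrite [A]flatmx0 [B]flatmx0; lra.
by apply: rho_le => //; rewrite leq_mul2r h orbT.
Qed.

Lemma rhoMl n (A B : 'M[complex]_n) : (rho (A *m B) <= rho A)%Re.
Proof. exact/rho_le_same/mxrankM_maxl. Qed.

Lemma rhoMr n (A B : 'M[complex]_n) : (rho (A *m B) <= rho B)%Re.
Proof. exact/rho_le_same/mxrankM_maxr. Qed.

Lemma rhoM_sub n (A A' B B' : 'M[complex]_n) :
  (rho (A *m B - A' *m B') <= rho (A - A') + rho (B - B'))%Re.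
Proof.
apply: Rle_trans (rho_triangle (A *m B') _ _) _; rewrite -mulmxBr -mulmxBl.
by rewrite Rplus_comm; apply: Rplus_le_compat; [exact: rhoMl|exact: rhoMr].
Qed.

Lemma rho_tensmx_lel m n (A : 'M[complex]_m) (B : 'M[complex]_n) :
  (rho (tensmx A B) <= rho A)%Re.
Proof.
case: m A => [|m] A.
  rewrite (_ : tensmx A B = 0) ?rho_0; first exact: rho_ge0.
  by apply/eqP; rewrite -mxrank_eq0 -leqn0; exact: rank_leq_row.
apply: rho_le => //; have := mxrank_tensmx_le A B; have := rank_leq_row B.
move=> h1 /leq_trans h2; rewrite mulnCA [X in (_ <= X)%N]mulnC leq_mul2r; apply/orP; right.
by apply: h2; rewrite leq_mul2l h1 orbT.
Qed.

Lemma rho_tensmx_ler m n (A : 'M[complex]_m) (B : 'M[complex]_n) :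
  (rho (tensmx A B) <= rho B)%Re.
Proof.
case: n B => [|n] B.
  rewrite (_ : tensmx A B = 0) ?rho_0; first exact: rho_ge0.
  by apply/eqP; rewrite -mxrank_eq0 -leqn0; apply: leq_trans (rank_leq_row _) _; rewrite muln0.
apply: rho_le => //; have := mxrank_tensmx_le A B; have := rank_leq_row A.
move=> h1 /leq_trans h2; rewrite mulnA leq_mul2r; apply/orP; right.
by apply: h2; rewrite mulnC leq_mul2l h1 orbT.
Qed.

Lemma rho_tensmx_sub m n (A A' : 'M[complex]_m) (B B' : 'M[complex]_n) :
  (rho (tensmx A B - tensmx A' B') <= rho (A - A') + rho (B - B'))%Re.
Proof.
apply: (Rle_trans _ _ _ (rho_triangle (tensmx A' B) (tensmx A B) (tensmx A' B'))).
rewrite -(tensmxBl A) -(tensmxBr A').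
by apply: Rplus_le_compat; [exact: rho_tensmx_lel|exact: rho_tensmx_ler].
Qed.

(** Dividing [mxrank_tensmx_sub1] by [m * n] leaves [1 - a b - (1 - a) (1 - b)], which is
    [a + b - 2 a b]. *)
Lemma rho_tensmx_sub1 m n (A : 'M[complex]_m) (B : 'M[complex]_n) :
  (0 < m)%N -> (0 < n)%N -> let a := rho (A - 1%:M) in let b := rho (B - 1%:M) in
  (a + b - 2 * a * b <= rho (tensmx A B - 1%:M))%Re.
Proof.
move=> m0 n0 a b; have := mxrank_tensmx_sub1 A B.
rewrite /a /b /rho {a b}.
set r := \rank _; set a := \rank _; set b := \rank _ => h.
have la : (a <= m)%N by exact: rank_leq_row.
have lb : (b <= n)%N by exact: rank_leq_row.
have mp : (0 < INR m)%Re by apply/lt_0_INR/ltP.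
have np : (0 < INR n)%Re by apply/lt_0_INR/ltP.
rewrite -multE mult_INR.
have h' : (INR m * INR n <= INR r + INR a * INR b + (INR m - INR a) * (INR n - INR b))%Re.
  rewrite -!minus_INR; [|exact/leP|exact/leP].
  by rewrite -!mult_INR -!plus_INR; apply/le_INR/leP.
apply: (Rmult_le_reg_r (INR m * INR n)); first nra.
have -> : (INR r / (INR m * INR n) * (INR m * INR n) = INR r)%Re by field; lra.
have -> : ((INR a / INR m + INR b / INR n - 2 * (INR a / INR m) * (INR b / INR n)) *
   (INR m * INR n) = INR a * INR n + INR b * INR m - 2 * INR a * INR b)%Re by field; lra.
nra.
Qed.

Lemma rho_block0 n (A : 'M[complex]_n) : rho (block_mx A 0 0 (0 : 'M_n)) = (rho A / 2)%Re.
Proof.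
rewrite /rho rank_diag_block_mx mxrank0 addn0 -plusE plus_INR.
case: n A => [|n] A; first by rewrite /= /Rdiv Rplus_0_r Rinv_0 !Rmult_0_r Rmult_0_l.
by have np : (0 < INR n.+1)%Re; [exact/lt_0_INR/ltP | field; lra].
Qed.

(** * Approximate representations and amplification *)

(* [rho] applied to convertible matrices may differ in the inferred ring instances, which
   [lra] treats as distinct atoms; ssreflect's [set] identifies them. *)
Ltac rlra :=
  repeat match goal with H : (_ <= _)%Re |- _ => revert H | H : (_ < _)%Re |- _ => revert H end;
  repeat match goal with |- context [@rho ?n ?a] =>
    let x := fresh "r" in set x := (@rho n a); move: {-1}x (erefl x) => {}x _
  end;
  repeat match goal with H : _ |- _ => clear H end; intros; lra.

(** Classical equality and choice on group carriers let finite subsets be sequences with boolean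
    membership. *)
HB.instance Definition _ (G : group) := gen_eqMixin (gcar G).
HB.instance Definition _ (G : group) := gen_choiceMixin (gcar G).

(** A local form of linear soficity. Invertibility is not demanded, so that truncated induced
    representations qualify; [approx_unitmx] restores it. *)
Definition approx (G : group) (E : seq G) (eps alpha : R) n (f : G -> 'M[complex]_n) : Prop :=
  [/\ (rho (f gone - 1%:M) <= eps)%Re,
      {in E &, forall g h, (rho (f (gmul g h) - f g *m f h) <= eps)%Re}
    & {in E, forall g, g != gone -> (alpha <= rho (f g - 1%:M))%Re}].

Lemma approx_weaken (G : group) (E : seq G) eps eps' alpha alpha' n (f : G -> 'M[complex]_n) :
  (eps <= eps')%Re -> (alpha' <= alpha)%Re -> approx E eps alpha f -> approx E eps' alpha' f.
Proof.
move=> he ha [h1 h2 h3]; split => [|g h gE hE|g gE g1].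
- exact: Rle_trans h1 he.
- exact: Rle_trans (h2 g h gE hE) he.
- exact: Rle_trans ha (h3 g gE g1).
Qed.

Lemma approx_1 (G : group) (E : seq G) n : approx E 0 0 (fun _ : G => 1%:M : 'M[complex]_n).
Proof.
by split=> [|g h _ _|g _ _]; rewrite ?mulmx1 subrr rho_0; apply: Rle_refl.
Qed.

Lemma approx_block1 (G : group) (E : seq G) eps alpha n (f : G -> 'M[complex]_n) :
  approx E eps alpha f ->
  approx E (eps / 2) (alpha / 2) (fun g => block_mx (f g) 0 0 (1%:M : 'M_n)).
Proof.
have blk (A B : 'M[complex]_n) : block_mx A 0 0 1%:M - block_mx B 0 0 1%:M =
    block_mx (A - B) 0 0 (0 : 'M_n).
  by rewrite opp_block_mx add_block_mx !oppr0 !addr0 subrr.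
move=> [h1 h2 h3]; rewrite /approx scalar_mx_block; split => [|g h gE hE|g gE g1].
- rewrite blk rho_block0. rlra.
- rewrite mulmx_block !mulmx0 !mul0mx !addr0 !add0r mulmx1 blk rho_block0.
  have ? := h2 g h gE hE; rlra.
- rewrite blk rho_block0; have ? := h3 g gE g1; rlra.
Qed.

Lemma rho_block1_sub1 n (A : 'M[complex]_n) :
  (rho (block_mx A 0 0 (1%:M : 'M_n) - 1%:M) <= 1 / 2)%Re.
Proof.
rewrite scalar_mx_block opp_block_mx add_block_mx !oppr0 !addr0 subrr rho_block0.
have ? := rho_le1 (A - 1%:M); rlra.
Qed.

(** For distances [u] of [f g] and [v] of [h g], write [u + v - 2 u v = u (1 - 2 v) + v]. As
    [v <= 1 / 2], this is at least [a + v (1 - 2 a)], and [a <= 1 / 4] leaves at least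
    [a + s / 2]. *)
Lemma approx_tensmx (G : group) (E : seq G) e e' a s m n
    (f : G -> 'M[complex]_m) (h : G -> 'M[complex]_n) :
  (0 < m)%N -> (0 < n)%N -> (a <= 1 / 4)%Re -> (0 <= s)%Re ->
  (forall g, (rho (h g - 1%:M) <= 1 / 2)%Re) ->
  approx E e a f -> approx E e' s h ->
  approx E (e + e') (a + s / 2) (fun g => tensmx (f g) (h g)).
Proof.
move=> m0 n0 a4 s0 h2 [f1 fM fs] [h1 hM hs]; split => [|x y xE yE|x xE x1].
- rewrite -tensmx1; apply: Rle_trans (rho_tensmx_sub _ _ _ _) _.
  exact: Rplus_le_compat.
- rewrite tensmxM; apply: Rle_trans (rho_tensmx_sub _ _ _ _) _.
  by apply: Rplus_le_compat; [exact: fM|exact: hM].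
- apply: Rle_trans (rho_tensmx_sub1 (f x) (h x) m0 n0).
  move: (fs x xE x1) (hs x xE x1) (h2 x).
  move: (rho _) (rho _) => u v ? ? ?; nra.
Qed.

(** Since [t] is fixed before [e], the error can afterwards be chosen small against [1 / t]. *)
Lemma approx_amplify (G : group) (E : seq G) (s : R) : (0 < s)%Re ->
  exists t : nat, forall N e n (f : G -> 'M[complex]_n),
    (0 < n)%N -> (0 <= e)%Re -> approx E e s f ->
    exists m (h : G -> 'M[complex]_m),
      [/\ (N <= m)%N, (0 < m)%N & approx E (INR t * e) (1 / 4) h].
Proof.
(* Each factor [f + 1] is separated by [s / 2] and tensoring adds half of that, so more than [1 / s]
   factors reach [1 / 4]. *)
move=> s0; have [t ht] := INR_unbounded (1 / s)%Re.
exists t => N e n f n0 e0 /approx_block1.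
set B := (fun g => _) => hB.
have : exists m (h : G -> 'M[complex]_m),
    [/\ (N <= m)%N, (0 < m)%N & approx E (INR t * e) (Rmin (1 / 4) (INR t * (s / 4))) h].
  elim: t {ht} => [|t [m [h [Nm m0 hh]]]].
    (* An identity factor of size [N + 1] makes the final size large without adding error. *)
    exists N.+1, (fun=> 1%:M); split => //; have := approx_1 E N.+1.
    by apply: approx_weaken; rewrite Rmult_0_l; [exact: Rle_refl | exact: Rmin_r].
  exists (m * (n + n))%N, (fun g => tensmx (h g) (B g)); split.
  - by rewrite (leq_trans Nm) // leq_pmulr // addn_gt0 n0.
  - by rewrite muln_gt0 m0 addn_gt0 n0.
  have n20 : (0 < n + n)%N by rewrite addn_gt0 n0.
  have b2 g : (rho (B g - 1%:M) <= 1 / 2)%Re by exact: rho_block1_sub1.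
  have s2 : (0 <= s / 2)%Re by lra.
  have := approx_tensmx m0 n20 (Rmin_l _ _) s2 b2 hh hB.
  apply: approx_weaken; rewrite S_INR; first lra.
  rewrite /Rmin; do 2 case: Rle_dec; lra.
move=> [m [h [Nm m0 hh]]]; exists m, h; split => //.
apply: approx_weaken hh; first exact: Rle_refl.
rewrite /Rmin; case: Rle_dec => ? //; first exact: Rle_refl.
have : (1 < INR t * s)%Re.
  by have := Rmult_lt_compat_r s _ _ s0 ht; rewrite /Rdiv Rmult_assoc Rinv_l; lra.
lra.
Qed.

(** * Folner sets from an invariant mean *)

(* Rado's argument: as long as some A i has two elements x1 and x2, one of them can be
   removed, since otherwise submodularity of cardinality contradicts Hall's condition. *)
Lemma hall_marriage (I T : finType) (A : I -> {set T}) :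
  (forall S : {set I}, #|S| <= #|\bigcup_(i in S) A i|)%N ->
  exists2 phi : I -> T, injective phi & forall i, phi i \in A i.
Proof.
have [N] := ubnP (\sum_i #|A i|)%N; elim: N A => // N IH A ltN hA.
have [/existsP[i0 /card_gt1P[x1 [x2 [x1A x2A x12]]]]|] := boolP [exists i, (1 < #|A i|)%N]; last first.
  rewrite negb_exists => /forallP le1.
  have A1 i : #|A i| == 1%N.
    rewrite eqn_leq leqNgt le1 /=.
    by have := hA [set i]; rewrite cards1 big_set1.
  have ex i : exists x, A i == [set x] by have /cards1P[x ->] := A1 i; exists x.
  exists (fun i => xchoose (ex i)) => [i j e|i]; last first.
    by rewrite {2}(eqP (xchooseP (ex i))) set11.
  apply/eqP; apply/negPn/negP => nij.
  have := hA [set i; j]; rewrite cards2 nij big_setU1 ?inE //= big_set1.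
  rewrite (eqP (xchooseP (ex i))) {1}(eqP (xchooseP (ex j))) e setUid cards1; done.
pose B x i := if i == i0 then A i0 :\ x else A i.
have subB x i : B x i \subset A i by rewrite /B; case: eqP => [->|_] //; exact: subD1set.
have decr x : x \in A i0 -> (\sum_i #|B x i| < \sum_i #|A i|)%N.
  move=> xA; rewrite (bigD1 i0) // [X in (_ < X)%N](bigD1 i0) //= {1}/B eqxx.
  rewrite -addSn leq_add //; first by rewrite [X in (_ < X)%N](cardsD1 x) xA.
  by apply: leq_sum => i _; exact/subset_leq_card.
have remove x : x \in A i0 -> ~ (forall S : {set I}, #|S| <= #|\bigcup_(i in S) B x i|)%N ->
    exists2 S : {set I}, i0 \in S & (#|\bigcup_(i in S) B x i| < #|S|)%N.
  move=> xA /existsNP[S /negP]; rewrite -ltnNge => ltS; exists S => //.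
  apply/negPn/negP => nS; have := hA S; rewrite leqNgt => /negP; apply.
  rewrite (eq_bigr (B x)) // => i iS; rewrite /B; case: eqP => // ei.
  by rewrite -ei iS in nS.
have use x : x \in A i0 -> (forall S : {set I}, #|S| <= #|\bigcup_(i in S) B x i|)%N ->
    exists2 phi : I -> T, injective phi & forall i, phi i \in A i.
  move=> xA hB; have [|phi inj hphi] := IH (B x) _ hB.
    by have := decr x xA; lia.
  by exists phi => // i; exact: (subsetP (subB x i)).
case: (EM (forall S : {set I}, #|S| <= #|\bigcup_(i in S) B x1 i|)%N); first exact: use.
case: (EM (forall S : {set I}, #|S| <= #|\bigcup_(i in S) B x2 i|)%N).
  by move=> h _; exact: use h.
move=> /(remove _ x2A)[S2 i2 lt2] /(remove _ x1A)[S1 i1 lt1]; exfalso.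
set U1 := \bigcup_(i in S1) _ in lt1; set U2 := \bigcup_(i in S2) _ in lt2.
have hU : (\bigcup_(i in S1 :|: S2) A i) \subset U1 :|: U2.
  apply/bigcupsP => i; rewrite inE => iS; apply/subsetP => y yA; rewrite inE.
  have [ei|ni] := eqVneq i i0.
    have [ey|ny] := eqVneq y x1.
      apply/orP; right; apply/bigcupP; exists i0 => //.
      by rewrite /B eqxx !inE ey x12 -ey -ei.
    apply/orP; left; apply/bigcupP; exists i0 => //.
    by rewrite /B eqxx !inE ny -ei.
  case/orP: iS => iS; apply/orP; [left|right]; apply/bigcupP; exists i => //;
  by rewrite /B (negPf ni).
have hI : (\bigcup_(i in (S1 :&: S2) :\ i0) A i) \subset U1 :&: U2.
  apply/bigcupsP => i; rewrite !inE => /and3P[ni iS1 iS2]; apply/subsetP => y yA.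
  by rewrite inE; apply/andP; split; apply/bigcupP; exists i => //; rewrite /B (negPf ni).
(* By [hU] and [hI], [#|U1| + #|U2|] is at least [#|S1| + #|S2| - 1], the loss being [i0]; by [lt1]
   and [lt2] it is at most [#|S1| + #|S2| - 2]. *)
have c1 := leq_trans (hA (S1 :|: S2)) (subset_leq_card hU).
have c2 := leq_trans (hA ((S1 :&: S2) :\ i0)) (subset_leq_card hI).
have := cardsUI S1 S2; have := cardsUI U1 U2.
have := cardsD1 i0 (S1 :&: S2); rewrite inE i1 i2 /=.
by move=> *; lia.
Qed.

Lemma uf_inhabited U (A : nat -> Prop) : ultrafilter U -> U A -> exists k, A k.
Proof.
move=> hU UA; apply: contrapT => /forallNP nA.
by apply: (uf_proper hU); apply: uf_up UA => // k /nA.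
Qed.

Lemma uf_cofinite U N : ultrafilter U -> nonprincipal U -> U (fun k => (N <= k)%N).
Proof.
move=> hU npU; elim: N => [|N IH]; first by apply: uf_up (uf_full hU).
have [/npU //|ne] := uf_ultra hU (fun k => k = N).
by apply: uf_up (uf_cap hU IH ne) => // k [le /eqP nk]; rewrite ltn_neqAle eq_sym nk.
Qed.

Lemma uf_pigeonhole U (T : eqType) (K : seq T) (c : nat -> T) :
  ultrafilter U -> U (fun n => c n \in K) -> exists2 k, k \in K & U (fun n => c n = k).
Proof.
move=> hU; elim: K => [|k K IH] UK.
  by case: (uf_proper hU); apply: uf_up UK.
have [Uk|nk] := uf_ultra hU (fun n => c n = k); first by exists k => //; rewrite mem_head.
have [|k' k'K Uk'] := IH.
  by apply: uf_up (uf_cap hU UK nk) => // n []; rewrite inE => /orP[/eqP|].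
by exists k' => //; rewrite inE k'K orbT.
Qed.

Lemma uf_all U (T : eqType) (E : seq T) (P : T -> nat -> Prop) :
  ultrafilter U -> (forall x, x \in E -> U (P x)) -> U (fun n => {in E, forall x, P x n}).
Proof.
move=> hU; elim: E => [|x E IH] hE; first by apply: uf_up (uf_full hU).
have Ux := hE x (mem_head x E).
have UE : U (fun n => {in E, forall x, P x n}).
  by apply: IH => y yE; apply: hE; rewrite inE yE orbT.
by apply: uf_up (uf_cap hU Ux UE) => // n [h1 h2] y; rewrite inE => /orP[/eqP ->|/h2].
Qed.

(** Gives finite sets exhausting a countable group; with a nonprincipal ultrafilter, each element
    lies in almost all of them. *)
Lemma finite_code_lt (T : eqType) (code : T -> nat) n : injective code ->
  exists s : seq T, forall x, (code x < n)%N -> x \in s.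
Proof.
move=> inj; elim: n => [|n [s hs]]; first by exists [::].
have [[y ey]|ny] := EM (exists y, code y = n); last first.
  exists s => x; rewrite ltnS leq_eqVlt => /orP[/eqP e|/hs //].
  by case: ny; exists x.
exists (y :: s) => x; rewrite ltnS leq_eqVlt inE => /orP[/eqP e|/hs ->]; last by rewrite orbT.
by rewrite (inj x y) ?eqxx // e ey.
Qed.

Lemma gmulI (G : group) (g : G) : injective (gmul g).
Proof. by move=> x y e; rewrite -(gmul1 x) -(gmulV g) -gmulA e gmulA gmulV gmul1. Qed.

Lemma gmulIr (G : group) (g : G) : injective (fun x : G => gmul x g).
Proof.
by move=> x y /= e; rewrite -(gmulr1 x) -(gmulVr g) gmulA e -gmulA gmulVr gmulr1.
Qed.

Definition gprod (G : group) (K F : seq G) : seq G := undup [seq gmul k x | k <- K, x <- F].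

Lemma mem_gprod (G : group) (K F : seq G) (y : G) :
  reflect (exists k x, [/\ k \in K, x \in F & y = gmul k x]) (y \in gprod K F).
Proof.
rewrite mem_undup; apply: (iffP allpairsP) => [[[k x] [kK xF e]]|[k [x [kK xF e]]]].
  by exists k, x.
by exists (k, x).
Qed.

(** Hall's theorem for pairs [(x, b)] with [x] in [F], each allowed the values [k x] with [k] in
    [K]. A set of pairs has at most twice as many elements as its projection to [F], so doubling is
    Hall's condition. *)
Lemma hall_doubling (G : group) (K F : seq G) :
  (forall S : seq G, uniq S -> (2 * size S <= size (gprod K S))%N) ->
  exists c : G -> bool -> G,
    (forall x b, x \in F -> c x b \in K) /\
    (forall x b x' b', x \in F -> x' \in F ->
       gmul (c x b) x = gmul (c x' b') x' -> x = x' /\ b = b').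
Proof.
move=> hK; pose X := gprod K F.
pose A (i : seq_sub F * bool) : {set seq_sub X} :=
  [set y | [exists k : seq_sub K, ssval y == gmul (ssval k) (ssval i.1)]].
have [S|phi inj hphi] := @hall_marriage _ _ A.
  pose S' := undup [seq ssval i.1 | i <- enum S].
  have le1 : (#|S| <= 2 * size S')%N.
    have -> : (2 * size S')%N = size [seq (x, b) | x <- S', b <- [:: false; true]].
      by rewrite size_allpairs mulnC.
    rewrite cardE -(size_map (fun i : seq_sub F * bool => (ssval i.1, i.2))).
    apply: uniq_leq_size.
      rewrite map_inj_uniq ?enum_uniq // => -[i b] [j b'] /= [e ->].
      by congr pair; exact: val_inj.
    move=> _ /mapP[[i b] iS ->]; apply/allpairsP; exists (ssval i, b); split => //=.
      by rewrite mem_undup; apply/mapP; exists (i, b).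
    by case: b {iS}.
  apply: leq_trans le1 (leq_trans (hK _ (undup_uniq _)) _).
  rewrite cardE -(size_map (fun y : seq_sub X => ssval y)).
  apply: uniq_leq_size; first exact: undup_uniq.
  move=> _ /mem_gprod[k [x [kK + ->]]]; rewrite mem_undup => /mapP[[[i iF] b]].
  rewrite mem_enum /= => iS ->.
  have hX : gmul k i \in X by apply/mem_gprod; exists k, i.
  apply/mapP; exists (SeqSub hX) => //; rewrite mem_enum; apply/bigcupP.
  exists (SeqSub iF, b) => //; rewrite inE; apply/existsP; exists (SeqSub kK) => /=; exact: eqxx.
have exk (i : seq_sub F * bool) : exists k, (k \in K) /\ ssval (phi i) = gmul k (ssval i.1).
  have := hphi i; rewrite inE => /existsP[[k kK] /eqP /= e].
  by exists k.
have /choice[c hc] (p : G * bool) : exists k, forall xF : p.1 \in F,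
    (k \in K) /\ ssval (phi (SeqSub xF, p.2)) = gmul k p.1.
  have [xF|nF] := EM (p.1 \in F); last by exists gone.
  have [k hk] := exk (SeqSub xF, p.2); exists k => xF'.
  by rewrite (bool_irrelevance xF' xF).
exists (fun x b => c (x, b)); split=> [x b xF|x b x' b' xF x'F].
  by have [] := hc (x, b) xF.
have [_ /= <-] := hc (x, b) xF; have [_ /= <-] := hc (x', b') x'F.
by move=> /val_inj/inj[-> ->].
Qed.

(** The matchings on an exhaustion have a pointwise limit along [U], since their values lie in the
    finite [K]. Two limit values are attained at a common stage, where injectivity is known. *)
Lemma infinite_doubling U (G : group) (K : seq G) :
  ultrafilter U -> nonprincipal U -> countable_group G ->
  (forall S : seq G, uniq S -> (2 * size S <= size (gprod K S))%N) ->
  exists c : G -> bool -> G,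
    (forall x b, c x b \in K) /\
    (forall x b x' b', gmul (c x b) x = gmul (c x' b') x' -> x = x' /\ b = b').
Proof.
move=> hU npU [code inj] hK.
have /choice[F hF] n := finite_code_lt n inj.
have /choice[c hc] n := hall_doubling (F n) hK.
have lim (p : G * bool) : exists k, k \in K /\ U (fun n => c n p.1 p.2 = k).
  have [|k kK Uk] := @uf_pigeonhole U _ K (fun n => c n p.1 p.2) hU; last by exists k.
  apply: uf_up (uf_cofinite (code p.1).+1 hU npU) => // n ltn.
  by have [h _] := hc n; apply/h/hF.
have /choice[d hd] := lim.
exists (fun x b => d (x, b)); split=> [x b|x b x' b' e]; first by have [] := hd (x, b).
have [_ U1] := hd (x, b); have [_ U2] := hd (x', b').
have U3 := uf_cofinite (maxn (code x) (code x')).+1 hU npU.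
have [n [[/= e1 e2]]] := uf_inhabited hU (uf_cap hU (uf_cap hU U1 U2) U3).
rewrite gtn_max => /andP[lx lx'].
by have [_ h] := hc n; apply: h; rewrite ?hF // e1 e2.
Qed.

Definition left_invariant_mean (G : group) (m : (G -> Prop) -> R) : Prop :=
  m (fun _ => True) = 1%Re /\
  (forall A, (0 <= m A)%Re) /\
  (forall A B, (forall x, A x -> B x -> False) ->
      m (fun x => A x \/ B x) = (m A + m B)%Re) /\
  (forall (g : G) A, m (fun x => A (gmul (ginv g) x)) = m A).

(** Finite additivity, meant for the pieces on which a piecewise translation is constant and for
    their translates. *)
Lemma mean_bigcup_eq (G : group) (m : (G -> Prop) -> R) (K : seq G) (P P' : G -> G -> Prop) :
  left_invariant_mean m -> uniq K ->
  (forall k l x, P k x -> P l x -> k = l) -> (forall k l x, P' k x -> P' l x -> k = l) ->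
  (forall k, m (P k) = m (P' k)) ->
  m (fun x => exists2 k, k \in K & P k x) = m (fun x => exists2 k, k \in K & P' k x).
Proof.
move=> [_ [_ [mD _]]] uK dP dP' e; elim: K uK => [_|k K IH /= /andP[kK uK]].
  by congr m; apply/funext => x; apply/propext; split => -[].
have split_cons (Q : G -> G -> Prop) : (forall k l x, Q k x -> Q l x -> k = l) ->
    m (fun x => exists2 l, l \in k :: K & Q l x) =
    (m (Q k) + m (fun x => exists2 l, l \in K & Q l x))%Re.
  move=> dQ; rewrite -mD => [|x Qk [l lK Ql]]; last by rewrite (dQ _ _ _ Qk Ql) lK in kK.
  congr m; apply/funext => x; apply/propext; split.
    by move=> [l]; rewrite inE => /orP[/eqP ->|lK] Ql; [left|right; exists l].
  move=> [Qk|[l lK Ql]]; first by exists k; rewrite ?mem_head.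
  by exists l => //; rewrite inE lK orbT.
by rewrite !split_cons // e IH.
Qed.

(** For each [b], the map [x |-> c x b * x] is injective and translates finitely many pieces, so its
    image has mean 1. The two images are disjoint, which would give total mean 2. *)
Lemma mean_no_doubling (G : group) (m : (G -> Prop) -> R) (K : seq G) (c : G -> bool -> G) :
  left_invariant_mean m -> (forall x b, c x b \in K) ->
  (forall x b x' b', gmul (c x b) x = gmul (c x' b') x' -> x = x' /\ b = b') -> False.
Proof.
move=> hm cK inj; have [m1 [m0 [mD mI]]] := hm.
have image1 b : m (fun y => exists x, y = gmul (c x b) x) = 1%Re.
  rewrite -m1; pose P k x := c x b = k.
  pose P' k y := P k (gmul (ginv k) y).
  have P'P k y : P' k y -> y = gmul (c (gmul (ginv k) y) b) (gmul (ginv k) y).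
    by rewrite {1}/P' /P => ->; rewrite gmulA gmulVr gmul1.
  transitivity (m (fun x => exists2 k, k \in undup K & P' k x)).
    congr m; apply/funext => y; apply/propext; split => [[x ->]|[k _ /P'P e]].
      exists (c x b); first by rewrite mem_undup.
      by rewrite /P' /P gmulA gmulV gmul1.
    by exists (gmul (ginv k) y).
  transitivity (m (fun x => exists2 k, k \in undup K & P k x)); last first.
    by congr m; apply/funext => x; apply/propext; split => // _; exists (c x b);
      rewrite ?mem_undup.
  apply: mean_bigcup_eq => //; first exact: undup_uniq.
  - move=> k l y h h'; have e1 := P'P _ _ h; have e2 := P'P _ _ h'.
    have [e _] := inj _ _ _ _ (etrans (esym e1) e2).
    by move: h h'; rewrite /P' /P e => -> ->.
  - by move=> k l x <- <-.
  - by move=> k; exact: mI.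
have m_le1 A : (m A <= 1)%Re.
  have := mD A (fun x => ~ A x) (fun x a na => na a).
  rewrite (_ : (fun x => A x \/ ~ A x) = (fun _ => True)) ?m1.
    by have := m0 (fun x => ~ A x); lra.
  by apply/funext => x; apply/propext; split => // _; exact: EM.
have := m_le1 (fun y => (exists x, y = gmul (c x true) x) \/ (exists x, y = gmul (c x false) x)).
rewrite mD ?image1; first by lra.
by move=> _ [x ->] [x' /inj[]].
Qed.

(** Bernoulli's inequality [(1 + 1 / q)^n >= 1 + n / q] at [n = q], with denominators cleared. *)
Lemma exp_succ_ge_double (q : nat) : (0 < q)%N -> (2 * q ^ q <= q.+1 ^ q)%N.
Proof.
move=> q0; have H n : ((q + n) * q ^ n <= q * q.+1 ^ n)%N.
  elim: n => [|n IH]; first by rewrite !expn0 addn0.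
  rewrite !expnS [X in (_ <= X)%N]mulnCA.
  have := leq_mul (leqnn q.+1) IH; move: (q ^ n)%N (q.+1 ^ n)%N => a b; nia.
have := H q; rewrite addnn -mul2n -mulnA mulnCA leq_pmul2l //.
Qed.

Lemma gprodA (G : group) (K L F : seq G) : gprod (gprod K L) F =i gprod K (gprod L F).
Proof.
move=> y; apply/mem_gprod/mem_gprod.
  move=> [_ [x [/mem_gprod[k [l [kK lL ->]]] xF ->]]].
  by exists k, (gmul l x); split; [|apply/mem_gprod; exists l, x|rewrite gmulA].
move=> [k [_ [kK /mem_gprod[l [x [lL xF ->]]] ->]]].
by exists (gmul k l), x; split; [apply/mem_gprod; exists k, l| |rewrite gmulA].
Qed.

(** If [S1] expanded all finite sets by [1 + 1 / q], its [q]-fold product set would double them,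
    against [mean_no_doubling]. A set that is expanded less is the Folner set. *)
Lemma folner_set U (G : group) (S : seq G) (q : nat) :
  ultrafilter U -> nonprincipal U -> countable_group G -> amenable G ->
  exists F : seq G, [/\ uniq F, (0 < size F)%N &
    {in S, forall s, (q * count (fun x => gmul s x \notin F) F <= size F)%N}].
Proof.
move=> hU npU cG [m hm].
have [->|q0] := posnP q; first by exists [:: gone].
pose S1 := gone :: S.
have [expand|] := EM (forall F : seq G, uniq F -> (q.+1 * size F <= q * size (gprod S1 F))%N).
  exfalso; pose K t := iter t (gprod S1) [:: gone].
  have [|c [cK cinj]] := @infinite_doubling U G (K q) hU npU cG; last first.
    exact: mean_no_doubling hm cK cinj.
  move=> F uF.
  have H t : (q.+1 ^ t * size F <= q ^ t * size (gprod (K t) F))%N.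
    elim: t => [|t IH].
      rewrite !expn0 !mul1n; apply: uniq_leq_size => // x xF.
      by apply/mem_gprod; exists gone, x; rewrite mem_head gmul1.
    have e : size (gprod (K t.+1) F) = size (gprod S1 (gprod (K t) F)).
      by apply/perm_size/uniq_perm; rewrite ?undup_uniq //; exact: gprodA.
    rewrite !expnS e; have := expand _ (undup_uniq [seq gmul k x | k <- K t, x <- F]).
    rewrite -/(gprod (K t) F); move: IH.
    move: (q.+1 ^ t)%N (q ^ t)%N (size F) (size (gprod (K t) F)) (size (gprod S1 _)).
    move=> a b u v w h1 h2; rewrite -mulnA.
    apply: (@leq_trans (q.+1 * (b * v))); first by rewrite leq_mul2l h1 orbT.
    by rewrite mulnCA (mulnC q) -mulnA leq_mul2l h2 orbT.
  have := leq_trans (leq_mul (exp_succ_ge_double q0) (leqnn (size F))) (H q).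
  by rewrite -mulnA mulnCA leq_pmul2l // expn_gt0 q0.
move=> /existsNP[F /not_implyP[uF /negP]]; rewrite -ltnNge => lt.
have F0 : (0 < size F)%N by case: F uF lt => // _; rewrite muln0 ltn0.
exists F; split => // s sS.
(* [S1 F] contains [F] and, disjoint from it, the points [s x] outside [F]. *)
suff : (count (fun x => gmul s x \notin F) F + size F <= size (gprod S1 F))%N.
  by move: lt; move: (count _ _) (size (gprod _ _)) (size F) => a b u; nia.
rewrite -size_filter -(size_map (gmul s)) -size_cat; apply: uniq_leq_size.
  rewrite cat_uniq map_inj_uniq ?filter_uniq ?uF ?andbT //; last exact: gmulI.
  apply/hasPn => x xF; apply/negP => /mapP[y]; rewrite mem_filter => /andP[nF _] e.
  by rewrite -e xF in nF.
move=> y; rewrite mem_cat => /orP[/mapP[x]|yF].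
  rewrite mem_filter => /andP[_ xF] ->; apply/mem_gprod; exists s, x.
  by rewrite inE sS orbT.
by apply/mem_gprod; exists gone, y; rewrite mem_head gmul1.
Qed.

(** * Block monomial matrices *)

Lemma INR_sum_le (I : finType) (A : {set I}) (a : I -> nat) (c : R) :
  (forall j, j \in A -> (INR (a j) <= c)%Re) -> (INR (\sum_(j in A) a j)%N <= INR #|A| * c)%Re.
Proof.
move=> h; rewrite -sum1_card; elim/big_rec2: _ => [|j y x /h aj le]; first by rewrite /=; lra.
by rewrite -!plusE !plus_INR Rmult_plus_distr_r Rmult_1_l; exact: Rplus_le_compat.
Qed.

Lemma mxrank_sum_le (F : fieldType) (I : finType) (A : {set I}) m n (M : I -> 'M[F]_(m, n)) :
  (\rank (\sum_(j in A) M j)%R <= \sum_(j in A) \rank (M j))%N.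
Proof.
elim/big_rec2: _ => [|j y x _ le]; first by rewrite mxrank0.
by apply: leq_trans (mxrank_add _ _) _; rewrite leq_add2l.
Qed.

(** Row vectors of length [f * n] are read as [f] blocks of length [n]: right multiplication by
    [rowsel] extracts block [j], by [rowput] inserts it. *)
Definition rowsel (F : fieldType) f n (j : 'I_f) : 'M[F]_(f * n, n) :=
  lin1_mx (row j \o vec_mx).
Definition rowput (F : fieldType) f n (j : 'I_f) : 'M[F]_(n, f * n) :=
  lin1_mx (mxvec \o mulmx (delta_mx j 0 : 'cV_f)).

Lemma rowput_sel (F : fieldType) f n (j k : 'I_f) :
  rowput F n j *m rowsel F n k = if j == k then 1%:M else 0.
Proof.
apply/eqP/mulmxP => u; rewrite mulmxA !mul_rV_lin1 /= mxvecK row_mul.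
apply/rowP => b; rewrite [LHS]mxE big_ord1 [X in X * _]mxE [X in X * _]mxE eqxx andbT eq_sym.
by case: eqP => _; rewrite ?mulmx1 ?mulmx0 ?mul1r // mul0r mxE.
Qed.

Lemma rowselK (F : fieldType) f n : \sum_(j < f) rowsel F n j *m rowput F n j = 1%:M.
Proof.
apply: eq_mulmx_mxvec => Z; rewrite mulmx_sumr mulmx1.
under eq_bigr do rewrite mulmxA !mul_rV_lin1 /= mxvecK.
rewrite -linear_sum; congr mxvec; apply/matrixP => i b; rewrite summxE.
rewrite (bigD1 i) //= big1 => [|j ji]; rewrite !mxE big_ord1 !mxE !eqxx ?andbT.
  by rewrite mul1r addr0.
by rewrite eq_sym (negPf ji) mul0r.
Qed.

Lemma rowsel_inj (F : fieldType) f n p (M M' : 'M[F]_(p, f * n)) :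
  (forall j, M *m rowsel F n j = M' *m rowsel F n j) -> M = M'.
Proof.
move=> e; rewrite -(mulmx1 M) -(mulmx1 M') -rowselK !mulmx_sumr.
by apply: eq_bigr => j _; rewrite !mulmxA e.
Qed.

Lemma mxrank_rowsel_le (F : fieldType) f n p (M : 'M[F]_(p, f * n)) :
  (\rank M <= \sum_(j in [set: 'I_f]) \rank (M *m rowsel F n j))%N.
Proof.
have eM : M = \sum_(j in [set: 'I_f]) M *m rowsel F n j *m rowput F n j.
  rewrite -{1}(mulmx1 M) -rowselK mulmx_sumr.
  by apply: eq_big => [j|j _]; rewrite ?in_setT ?mulmxA.
rewrite {1}eM; apply: leq_trans (mxrank_sum_le _ _) _; apply: leq_sum => j _.
exact: mxrankM_maxl.
Qed.

(** The projection [P] onto the blocks in [A] is injective on the row space of [K] and has rank at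
    most [#|A| * n]. *)
Lemma mxrank_rowsel_inj (F : fieldType) f n p (K : 'M[F]_(p, f * n)) (A : {set 'I_f}) :
  (forall v : 'rV_(f * n), (v <= K)%MS -> {in A, forall j, v *m rowsel F n j = 0} -> v = 0) ->
  (\rank K <= #|A| * n)%N.
Proof.
move=> inj; pose P := \sum_(j in A) rowsel F n j *m rowput F n j.
have PA j : j \in A -> P *m rowsel F n j = rowsel F n j.
  move=> jA; rewrite mulmx_suml (bigD1 j) //= -mulmxA rowput_sel eqxx mulmx1 big1 ?addr0 //.
  by move=> i /andP[_ /negPf ij]; rewrite -mulmxA rowput_sel ij mulmx0.
rewrite -(mxrank_mul_ker K P).
have -> : \rank (K :&: kermx P)%MS = 0%N.
  apply/eqP; rewrite mxrank_eq0; apply/eqP/row_matrixP => i; rewrite row0.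
  have := row_sub i (K :&: kermx P)%MS; rewrite sub_capmx => /andP[vK /sub_kermxP vP].
  by apply: inj => // j jA; rewrite -(PA j jA) mulmxA vP mul0mx.
rewrite addn0 (leq_trans (mxrankM_maxr _ _)) // (leq_trans (mxrank_sum_le _ _)) //.
rewrite -sum1_card big_distrl /=; apply: leq_sum => j _; rewrite mul1n.
exact: leq_trans (mxrankM_maxl _ _) (rank_leq_col _).
Qed.

(** Block column [j] has the single block [C j] in block row [s j], or is zero if [s j] is
    [None]. *)
Definition block_monomial (F : fieldType) f n (s : 'I_f -> option 'I_f) (C : 'I_f -> 'M[F]_n) :
    'M[F]_(f * n) :=
  \sum_j (if s j is Some i then rowsel F n i *m C j else 0) *m rowput F n j.

Lemma block_monomial_sel (F : fieldType) f n (s : 'I_f -> option 'I_f) (C : 'I_f -> 'M[F]_n) j :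
  block_monomial s C *m rowsel F n j = if s j is Some i then rowsel F n i *m C j else 0.
Proof.
rewrite mulmx_suml (bigD1 j) //= -mulmxA rowput_sel eqxx mulmx1 big1 ?addr0 //.
by move=> i /negPf ij; rewrite -mulmxA rowput_sel ij mulmx0.
Qed.

(** Blocks in [B] contribute rank at most [n] each, the others at most [e n]. *)
Lemma rho_rowsel_le f n (M : 'M[complex]_(f * n)) (B : {set 'I_f}) (e : R) :
  (0 < f)%N -> (0 < n)%N ->
  (forall j, j \notin B -> (INR (\rank (M *m rowsel _ n j)) <= e * INR n)%Re) ->
  (0 <= e)%Re -> (rho M <= e + INR #|B| / INR f)%Re.
Proof.
move=> f0 n0 h e0; have := mxrank_rowsel_le M; rewrite (big_setID B) /= setTI setTD.
have fp : (0 < INR f)%Re by apply/lt_0_INR/ltP.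
have np : (0 < INR n)%Re by apply/lt_0_INR/ltP.
move=> /leP/le_INR; rewrite -plusE plus_INR.
have h1 : (INR (\sum_(j in B) \rank (M *m rowsel _ n j))%N <= INR #|B| * INR n)%Re.
  by apply: INR_sum_le => j _; apply/le_INR/leP/rank_leq_col.
have h2 : (INR (\sum_(j in ~: B) \rank (M *m rowsel _ n j))%N <= INR #|~: B| * (e * INR n))%Re.
  by apply: INR_sum_le => j; rewrite inE => /h.
have h3 : (INR #|~: B| <= INR f)%Re.
  by apply/le_INR/leP; rewrite -[X in (_ <= X)%N]card_ord max_card.
move: h1 h2; rewrite /rho; set r1 := INR (\sum_(j in B) _); set r2 := INR (\sum_(j in _) _).
move: r1 r2 => r1 r2; set r := INR (\rank M); move: r => r h1 h2 h4.
rewrite -multE mult_INR; apply: (Rmult_le_reg_r (INR f * INR n)); first nra.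
have -> : (r / (INR f * INR n) * (INR f * INR n) = r)%Re by field; lra.
have -> : ((e + INR #|B| / INR f) * (INR f * INR n) =
   INR f * (e * INR n) + INR #|B| * INR n)%Re by field; lra.
have : (INR #|~: B| * (e * INR n) <= INR f * (e * INR n))%Re.
  by apply: Rmult_le_compat_r => //; nra.
lra.
Qed.

Lemma rank_le_rho n (A : 'M[complex]_n) (m : nat) (S : 'M[complex]_(m, n)) (e : R) :
  (rho A <= e)%Re -> (INR (\rank (S *m A)) <= e * INR n)%Re.
Proof.
case: n A S => [|n] A S h.
  by rewrite [A]flatmx0 mulmx0 mxrank0 /=; lra.
have np : (0 < INR n.+1)%Re by apply/lt_0_INR/ltP.
apply: (@Rle_trans _ (INR (\rank A))); first by apply/le_INR/leP/mxrankM_maxr.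
have := Rmult_le_compat_r _ _ _ (Rlt_le _ _ np) h.
by rewrite /rho /Rdiv Rmult_assoc Rinv_l ?Rmult_1_r; lra.
Qed.

Lemma rho_kermx_le n (M : 'M[complex]_n) (e : R) : (0 < n)%N ->
  (INR (\rank (kermx M)) <= e * INR n)%Re -> (1 - e <= rho M)%Re.
Proof.
move=> n0; rewrite mxrank_ker minus_INR; last by apply/leP; exact: rank_leq_row.
have np : (0 < INR n)%Re by apply/lt_0_INR/ltP.
rewrite /rho; set r := INR (\rank M); move: r => r h.
apply: (Rmult_le_reg_r (INR n)) => //; rewrite /Rdiv Rmult_assoc Rinv_l; lra.
Qed.

(** Block [j] of a kernel vector lies in the kernel of [D j], of dimension at most
    [(1 - alpha) n]. *)
Lemma rho_block_diag_ge f n (M : 'M[complex]_(f * n)) (D : 'I_f -> 'M[complex]_n) (alpha : R) :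
  (0 < f)%N -> (0 < n)%N ->
  (forall j, M *m rowsel _ n j = rowsel _ n j *m D j) ->
  (forall j, (alpha <= rho (D j))%Re) -> (alpha <= rho M)%Re.
Proof.
move=> f0 n0 hM hD; have -> : alpha = (1 - (1 - alpha))%Re by lra.
apply: rho_kermx_le => //; first by rewrite muln_gt0 f0.
apply: (@Rle_trans _ (INR (\sum_(j in [set: 'I_f]) \rank (kermx M *m rowsel _ n j))%N)).
  by apply/le_INR/leP; exact: mxrank_rowsel_le.
apply: Rle_trans (INR_sum_le (c := ((1 - alpha) * INR n)%Re) _) _ => [j _|]; last first.
  by rewrite cardsT card_ord -multE mult_INR; lra.
have /mxrankS/leP/le_INR : (kermx M *m rowsel _ n j <= kermx (D j))%MS.
  by apply/sub_kermxP; rewrite -mulmxA -hM mulmxA mulmx_ker mul0mx.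
rewrite mxrank_ker minus_INR; last by apply/leP; exact: rank_leq_row.
have := Rmult_le_compat_r (INR n) _ _ (pos_INR n) (hD j).
have np : (0 < INR n)%Re by apply/lt_0_INR/ltP.
by rewrite /rho /Rdiv Rmult_assoc Rinv_l ?Rmult_1_r; lra.
Qed.

(* A fixed vector has row j equal to row (s j) times C j, so for any ranking mu it is
   determined by the rows j with mu j <= mu (s j).  An increasing and a decreasing ranking
   give disjoint sets of rows, so one of the two has at most f / 2 elements. *)
Lemma rho_block_derangement_ge f n (s : 'I_f -> option 'I_f) (C : 'I_f -> 'M[complex]_n) :
  (0 < f)%N -> (0 < n)%N -> (forall j, s j != Some j) ->
  (1 / 2 <= rho (block_monomial s C - 1%:M))%Re.
Proof.
move=> f0 n0 der; set M := _ - _.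
pose A (mu : 'I_f -> nat) := [set j | if s j is Some i then (mu j <= mu i)%N else false].
have kerA mu : (\rank (kermx M) <= #|A mu| * n)%N.
  apply: mxrank_rowsel_inj => v /sub_kermxP; rewrite mulmxBr mulmx1 => /eqP.
  rewrite subr_eq0 => /eqP fix_v vA; apply: (@rowsel_inj _ f n) => j; rewrite mul0mx.
  have [N] := ubnP (mu j); elim: N j => // N IH j; rewrite ltnS => jN.
  have [/vA //|] := boolP (j \in A mu); rewrite inE => jA.
  rewrite -fix_v -mulmxA block_monomial_sel; move: jA.
  case: (s j) => [i|] jA; last by rewrite mulmx0.
  by rewrite mulmxA IH ?mul0mx //; lia.
pose B := A (fun j => f - j)%N.
have disj : (#|A val| + #|B| <= f)%N.
  rewrite -cardsUI (_ : A val :&: B = set0) ?cards0 ?addn0.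
    by rewrite -[X in (_ <= X)%N]card_ord max_card.
  apply/setP => j; rewrite !inE; have := der j; case: (s j) => // i ij.
  apply/negP => /andP[/= h1 h2]; case/eqP: ij; congr Some; apply/val_inj => /=.
  by have := ltn_ord i; have := ltn_ord j; lia.
have -> : (1 / 2 = 1 - 1 / 2)%Re by lra.
apply: rho_kermx_le => //; first by rewrite muln_gt0 f0.
have /leP/le_INR : (2 * \rank (kermx M) <= f * n)%N.
  have := kerA val; have := kerA (fun j => f - j)%N; rewrite -/B.
  by move: (\rank _) #|A val| #|B| disj => r a b; nia.
rewrite mult_INR [INR 2]/=; lra.
Qed.

(** * Induction to G *)

Section Induction.
Variables (G : group) (H : G -> Prop) (hH : normal_subgroup G H).
Local Notation Q := (quotient_group hH).
Local Notation HG := (subgroup_group hH).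

Definition qact (g : G) (q : Q) : Q := gmul (qclass H g : Q) q.

Lemma qact_mul g g' q : qact (gmul g g') q = qact g (qact g' q).
Proof.
rewrite /qact gmulA; congr gmul; apply: q_eq => /=.
by apply: (coset_mul hH); rewrite qrepE.
Qed.

Lemma qact1 q : qact gone q = q.
Proof. exact: (gmul1 q). Qed.

Lemma coset_qact g q : coset H (qrep (qact g q)) = coset H (gmul g (qrep q)).
Proof. by rewrite qrepE /=; apply: coset_mul => //; rewrite qrepE. Qed.

(* g sigma(q) = sigma(g q) cocycle g q, where sigma = qrep is the section of G -> G / H. *)
Definition cocycle (g : G) (q : Q) : HG :=
  exist _ (gmul (ginv (qrep (qact g q))) (gmul g (qrep q)))
    ((coset_eqP hH _ _).1 (coset_qact g q)).

Lemma cocycle_mul g g' q : cocycle (gmul g g') q = gmul (cocycle g (qact g' q)) (cocycle g' q).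
Proof.
apply: sg_eq => /=; rewrite qact_mul -!gmulA; congr gmul; congr gmul.
by rewrite gmulA gmulVr gmul1.
Qed.

Lemma cocycle1 q : cocycle gone q = gone.
Proof. by apply: sg_eq => /=; rewrite qact1 gmul1 gmulV. Qed.

Lemma qclass_sub g : H g -> qclass H g = gone :> Q.
Proof.
move=> Hg; apply: q_eq => /=; apply/(coset_eqP hH); rewrite gmulr1; exact: (ns_inv hH).
Qed.

Lemma qact_fixed g q : qact g q = q -> H g.
Proof.
move=> e; have : (qclass H g : Q) = gone.
  by apply: (@gmulIr Q q); rewrite gmul1.
move/(f_equal (@proj1_sig _ _)) => /= /(coset_eqP hH); rewrite gmulr1 => /(ns_inv hH).
by rewrite ginvK.
Qed.

(** For [g] in [H] the cocycle is the conjugate of [g] by [qrep q]. *)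
Lemma cocycle_neq1 g q : H g -> g != gone -> cocycle g q != gone.
Proof.
move=> Hg; apply: contraNneq => /(f_equal (@proj1_sig _ _)) /=.
rewrite /qact (qclass_sub Hg) (gmul1 (q : Q)) => e.
apply/eqP; apply: (@gmulIr G (qrep q)); apply: (@gmulI G (ginv (qrep q))).
by rewrite e gmul1 gmulV.
Qed.

Variables (F : seq Q) (n : nat) (phi : HG -> 'M[complex]_n).

Definition folner_pt (j : 'I_(size F)) : Q := nth gone F j.
(** The partial action of [g] on positions in [F]: [index] returns [size F] when the translate
    leaves [F], and [insub] then gives [None]. *)
Definition folner_act (g : G) (j : 'I_(size F)) : option 'I_(size F) :=
  insub (index (qact g (folner_pt j)) F).
Definition induced (g : G) : 'M[complex]_(size F * n) :=
  block_monomial (folner_act g) (fun j => phi (cocycle g (folner_pt j))).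

Lemma folner_ptP j : folner_pt j \in F. Proof. exact: mem_nth. Qed.

Lemma folner_act_some g j i : folner_act g j = Some i -> folner_pt i = qact g (folner_pt j).
Proof.
rewrite /folner_act; case: insubP => // k lt ek [<-]; rewrite /folner_pt ek nth_index //.
by rewrite -index_mem.
Qed.

Lemma folner_act_none g j : folner_act g j = None -> qact g (folner_pt j) \notin F.
Proof. by rewrite /folner_act; case: insubP => // nF _; rewrite -index_mem. Qed.

Hypothesis (uF : uniq F).

Lemma folner_act_id g j : qact g (folner_pt j) = folner_pt j -> folner_act g j = Some j.
Proof.
move=> e; rewrite /folner_act e /folner_pt index_uniq //.
by rewrite (insubT (fun k => k < size F)%N (ltn_ord j)); congr Some; apply: val_inj.
Qed.

Lemma folner_boundary (P : pred Q) : #|[set j | P (folner_pt j)]| = count P F.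
Proof.
rewrite -[in RHS](mkseq_nth gone F) /mkseq count_map -val_enum_ord count_map cardsE cardE.
by rewrite -size_filter enumT.
Qed.

Lemma approx_induced (E : seq G) (e d : R) :
  (0 < size F)%N -> (0 < n)%N -> (0 <= e)%Re -> (0 <= d)%Re ->
  {in E, forall g, (INR (count (fun q => qact g q \notin F) F) <= d * INR (size F))%Re} ->
  approx [seq cocycle g q | g <- E, q <- F] e (1 / 4) phi ->
  approx E (e + d) (1 / 4) induced.
Proof.
move=> F0 n0 e0 d0 hF [phi1 phiM phis].
have fp : (0 < INR (size F))%Re by apply/lt_0_INR/ltP.
split => [|g g' gE g'E|g gE g1].
- apply: (@Rle_trans _ e); last lra.
  have -> : e = (e + INR #|(set0 : {set 'I_(size F)})| / INR (size F))%Re.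
    by rewrite cards0 /= /Rdiv Rmult_0_l Rplus_0_r.
  apply: rho_rowsel_le => // j _.
  rewrite mulmxBl mul1mx block_monomial_sel folner_act_id ?qact1 // cocycle1.
  rewrite -{2}(mulmx1 (rowsel _ n j)) -mulmxBr; exact: rank_le_rho.
(* Only the boundary of [g'] counts: if [g'] keeps a point in [F] and [g] then moves it out, both
   block columns vanish. *)
- pose B := [set j | qact g' (folner_pt j) \notin F].
  apply: (@Rle_trans _ (e + INR #|B| / INR (size F))%Re); last first.
    apply: Rplus_le_compat_l; apply: (Rmult_le_reg_r (INR (size F))) => //.
    rewrite /Rdiv Rmult_assoc Rinv_l ?Rmult_1_r; last lra.
    by rewrite (folner_boundary (fun q => qact g' q \notin F)); exact: hF.
  apply: rho_rowsel_le => // j; rewrite inE negbK => jF.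
  rewrite mulmxBl -mulmxA !block_monomial_sel.
  case ei: (folner_act g' j) => [i|]; last by rewrite (negPf (folner_act_none ei)) in jF.
  have pi := folner_act_some ei.
  rewrite mulmxA block_monomial_sel (_ : folner_act (gmul g g') j = folner_act g i); last first.
    by rewrite /folner_act qact_mul pi.
  case: (folner_act g i) => [k|]; last first.
    by rewrite mul0mx subrr mxrank0 /=; apply: Rmult_le_pos => //; exact: pos_INR.
  rewrite -mulmxA -mulmxBr cocycle_mul -pi; apply/rank_le_rho/phiM.
    by apply: allpairs_f => //; exact: folner_ptP.
  by apply: allpairs_f => //; exact: folner_ptP.
- have [Hg|nHg] := EM (H g).
    apply: (@rho_block_diag_ge _ _ _ (fun j => phi (cocycle g (folner_pt j)) - 1%:M)) => // j.
      rewrite mulmxBl mul1mx block_monomial_sel folner_act_id.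
        by rewrite mulmxBr mulmx1.
      by rewrite /qact (qclass_sub Hg) (gmul1 (_ : Q)).
    apply: phis; last exact: cocycle_neq1.
    by apply: allpairs_f => //; exact: folner_ptP.
  apply: Rle_trans (rho_block_derangement_ge _ F0 n0 _); first lra.
  move=> j; apply/eqP => /folner_act_some ej; apply: nHg; exact: (qact_fixed (esym ej)).
Qed.
End Induction.

(** * Ultraproducts and finite approximations *)

(** [a b^-1 - 1 = (a - b) b^-1], and the unit [b^-1] preserves rank. *)
Lemma rho_mx_defect n (a b : 'M[complex]_n) : b \in unitmx -> rho (mx_defect a b) = rho (a - b).
Proof.
move=> ub; rewrite /rho; congr (INR _ / _)%Re.
have -> : mx_defect a b = (a - b) *m invmx b by rewrite mulmxBl mulmxV.
by rewrite mxrankMfree // row_free_unit unitmx_inv.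
Qed.

Lemma pos_lower_bound (T : eqType) (E : seq T) (r : T -> R) :
  (forall x, (0 < r x)%Re) -> exists2 s, (0 < s)%Re & {in E, forall x, (s <= r x)%Re}.
Proof.
move=> r0; elim: E => [|x E [s s0 hs]]; first by exists 1%Re => //; lra.
exists (Rmin s (r x)); first exact: Rmin_pos.
move=> y; rewrite inE => /orP[/eqP ->|/hs le]; first exact: Rmin_r.
exact: Rle_trans (Rmin_l _ _) le.
Qed.

(** The separation [s] depends on [E] only, not on [e]. It is half of the least distance from
    [f gone] in the ultraproduct; the other half pays for replacing [f gone] by the identity. *)
Lemma linear_sofic_approx (G : group) (E : seq G) : linear_sofic G ->
  exists2 s, (0 < s)%Re & forall e, (0 < e)%Re ->
    exists n (f : G -> 'M[complex]_n), (0 < n)%N /\ approx E e s f.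
Proof.
move=> [_ [U [n [f [hU [npU [ninf [fu [fM finj]]]]]]]]].
have sep g : exists r, (0 < r)%Re /\
    (g != gone -> U (fun k => (r <= rho (f g k - f gone k))%Re)).
  have [->|ng] := eqVneq g gone; first by exists 1%Re; split => //; lra.
  have /existsNP[r /not_implyP[r0 nU]] : ~ ueq U n (f g) (f gone).
    by move/finj => e; rewrite e eqxx in ng.
  exists r; split => // _; have [//|h] := uf_ultra hU (fun k => (r <= rho (f g k - f gone k))%Re).
  case: nU; apply: uf_up h => // k /Rnot_le_lt lt.
  by rewrite rho_mx_defect // Rabs_pos_eq //; exact: rho_ge0.
have /choice[r hr] := sep.
have [s s0 hs] := @pos_lower_bound _ E r (fun g => (hr g).1).
exists (s / 2)%Re => [|e e0]; first lra.
pose e1 := Rmin e (s / 2); have e10 : (0 < e1)%Re by apply: Rmin_pos; lra.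
have close g h : U (fun k => (rho (f (gmul g h) k - f g k *m f h k) < e1)%Re).
  apply: uf_up (fM g h e1 e10) => // k; rewrite rho_mx_defect ?unitmx_mul ?fu //.
  by rewrite Rabs_pos_eq //; exact: rho_ge0.
have [N hN] := ninf 1%N.
have Usep : U (fun k => {in E, forall g, g != gone -> (r g <= rho (f g k - f gone k))%Re}).
  apply: (uf_all hU) => g _; have [->|ng] := eqVneq g gone; first by apply: uf_up (uf_full hU).
  by apply: uf_up ((hr g).2 ng).
have Umul : U (fun k => {in E, forall g, {in E, forall h,
    (rho (f (gmul g h) k - f g k *m f h k) < e1)%Re}}).
  by apply: (uf_all hU) => g _; apply: (uf_all hU) => h _.
have [k [[[k1 k2] k3] k4]] := uf_inhabited hU
  (uf_cap hU (uf_cap hU (uf_cap hU Usep Umul) (close gone gone)) (uf_cofinite N hU npU)).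
have ee : (e1 <= e)%Re by exact: Rmin_l.
have es : (e1 <= s / 2)%Re by exact: Rmin_r.
(* [f gone] is invertible and close to its square, hence close to the identity. *)
have f1 : (rho (f gone k - 1%:M) < e1)%Re.
  rewrite rho_distC; move: k3; rewrite gmul1 /rho -{1}(mulmx1 (f gone k)) -mulmxBr.
  by rewrite -mxrank_tr trmx_mul mxrankMfree ?mxrank_tr // row_free_unit unitmx_tr.
exists (n k), (f ^~ k); split; first exact: hN.
split => [|g h gE hE|g gE ng].
- exact: Rle_trans (Rlt_le _ _ f1) ee.
- exact: Rle_trans (Rlt_le _ _ (k2 g gE h hE)) ee.
- have t := rho_triangle 1%:M (f g k) (f gone k).
  rewrite (rho_distC 1%:M) in t.
  have ? := k1 g gE ng; have ? := hs g gE; rlra.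
Qed.

(** As [f x *m f (ginv x)] is within [2 e] of the identity, [f x] has normalized corank at most
    [2 e], and so lies that close to a unit. *)
Lemma approx_unitmx (G : group) (E : seq G) e n (f : G -> 'M[complex]_n) :
  (0 < n)%N -> approx E e (1 / 4) f ->
  exists F : G -> 'M[complex]_n, (forall g, F g \in unitmx) /\
    forall g h,
      {subset [:: g; h; ginv g; ginv h; gmul g h; ginv (gmul g h); gmul (ginv g) h] <= E} ->
      (rho (F (gmul g h) - F g *m F h) <= 7 * e)%Re /\
      (g <> h -> (1 / 4 - 7 * e <= rho (F g - F h))%Re).
Proof.
move=> n0 [f1 fM fs].
have /choice[F hF] g : exists B, B \in unitmx /\ \rank (f g - B) = (n - \rank (f g))%N.
  by have [B uB rB] := exists_unitmx_rank_sub (f g); exists B.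
exists F; split => [g|g h sub]; first by have [] := hF g.
have near x : x \in E -> ginv x \in E -> (rho (f x - F x) <= 2 * e)%Re.
  move=> xE xE'; have [_ r] := hF x.
  have -> : rho (f x - F x) = (1 - rho (f x))%Re.
    have np : (0 < INR n)%Re by apply/lt_0_INR/ltP.
    rewrite /rho r minus_INR; last by apply/leP; exact: rank_leq_row.
    by field; lra.
  have h1 := fM x (ginv x) xE xE'; rewrite gmulVr in h1.
  have h2 := rhoD (1%:M - f x *m f (ginv x)) (f x *m f (ginv x)).
  rewrite subrK rho_1 // in h2.
  have h3 := rho_triangle (f gone) 1%:M (f x *m f (ginv x)).
  rewrite (rho_distC 1%:M (f gone)) in h3.
  have h4 := rhoMl (f x) (f (ginv x)); rlra.
have [gE hE gE' hE' ghE] : [/\ g \in E, h \in E, ginv g \in E, ginv h \in E & gmul g h \in E].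
  by split; apply: sub; rewrite !inE eqxx ?orbT.
have [ghE' gVhE] : ginv (gmul g h) \in E /\ gmul (ginv g) h \in E.
  by split; apply: sub; rewrite !inE eqxx ?orbT.
have ng := near g gE gE'; have nh := near h hE hE'; have ngh := near _ ghE ghE'.
(* For products, [7 e] is [e] for [f] and [2 e] for each of the three replacements by units. For
   separation, [3 e] leads from [f (gmul (ginv g) h)] to [f g - f h], and [4 e] covers two
   replacements. *)
split => [|gh].
  have t1 := rho_triangle (f (gmul g h)) (F (gmul g h)) (F g *m F h).
  have t2 := rho_triangle (f g *m f h) (f (gmul g h)) (F g *m F h).
  have t3 := rhoM_sub (f g) (F g) (f h) (F h).
  rewrite (rho_distC (F (gmul g h)) (f (gmul g h))) in t1.
  have t4 := fM g h gE hE; rlra.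
have ne : gmul (ginv g) h != gone.
  by apply/eqP => e1; apply: gh; apply: (@gmulI G (ginv g)); rewrite e1 gmulV.
have s1 := fs _ gVhE ne.
have s2 := rho_triangle (f (ginv g) *m f h) (f (gmul (ginv g) h)) 1%:M.
have s3 := fM (ginv g) h gE' hE.
have s4 := rho_triangle (f (ginv g) *m f g) (f (ginv g) *m f h) 1%:M.
have s5 : (rho (f (ginv g) *m f h - f (ginv g) *m f g) <= rho (f g - f h))%Re.
  by rewrite -mulmxBr (rho_distC (f g)); exact: rhoMr.
have s6 := rho_triangle (f gone) (f (ginv g) *m f g) 1%:M.
have s7 := fM (ginv g) g gE' gE; rewrite gmulV rho_distC in s7.
have s8 := rho_triangle (F g) (f g) (f h).
have s9 := rho_triangle (F h) (F g) (f h).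
rewrite (rho_distC (F h) (f h)) in s9; rlra.
Qed.

(** Stage [k] uses the elements of code below [k], error [1 / (k + 1)] and size at least [k]; any
    pair [g], [h] has all of [pts g h] available from some stage on. *)
Lemma approx_linear_sofic U (G : group) :
  ultrafilter U -> nonprincipal U -> countable_group G ->
  (forall (E : seq G) e N, (0 < e)%Re ->
     exists n (f : G -> 'M[complex]_n), [/\ (N <= n)%N, (0 < n)%N & approx E e (1 / 4) f]) ->
  linear_sofic G.
Proof.
move=> hU npU cG loc; split => //; have [code inj] := cG.
have /choice[E hE] k := finite_code_lt k inj.
pose e k := (/ INR k.+1)%Re.
have e0 k : (0 < e k)%Re by apply/Rinv_0_lt_compat/lt_0_INR/ltP.
pose pts (g h : G) := [:: g; h; ginv g; ginv h; gmul g h; ginv (gmul g h); gmul (ginv g) h].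
have /choice[p hp] k : exists p : {n & G -> 'M[complex]_n},
    [/\ (k <= projT1 p)%N, forall g, projT2 p g \in unitmx &
      forall g h, {subset pts g h <= E k} ->
      (rho (projT2 p (gmul g h) - projT2 p g *m projT2 p h) <= 7 * e k)%Re /\
      (g <> h -> (1 / 4 - 7 * e k <= rho (projT2 p g - projT2 p h))%Re)].
  have [n [f [kn n0 hf]]] := loc (E k) (e k) k (e0 k).
  have [F [uF hF]] := approx_unitmx n0 hf.
  by exists (existT _ n F).
have large g h eps : (0 < eps)%Re ->
    U (fun k => {subset pts g h <= E k} /\ (7 * e k < eps)%Re).
  move=> eps0; have [K hK] := INR_unbounded (7 / eps)%Re.
  pose N := (\max_(x <- pts g h) code x)%N.
  apply: uf_up (uf_cofinite (maxn N.+1 K) hU npU) => // k; rewrite geq_max => /andP[Nk Kk].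
  split => [x xp|].
    by apply/hE/(leq_ltn_trans _ Nk); rewrite /N (big_rem x) //= leq_maxl.
  have kp : (0 < INR k.+1)%Re by apply/lt_0_INR/ltP.
  have lt : (7 / eps < INR k.+1)%Re.
    by apply: Rlt_le_trans hK _; apply/le_INR/leP; exact: leqW.
  apply: (Rmult_lt_reg_r (INR k.+1)) => //; rewrite /e Rmult_assoc Rinv_l; last lra.
  have := Rmult_lt_compat_r _ _ _ eps0 lt.
  rewrite /Rdiv Rmult_assoc Rinv_l; lra.
exists U, (fun k => projT1 (p k)), (fun g k => projT2 (p k) g); split => //; split => //.
split; first by move=> N; exists N => k Nk; have [kn _ _] := hp k; exact: leq_trans Nk kn.
have pu g k : projT2 (p k) g \in unitmx by have [_] := hp k.
split => //; split => [g h eps eps0|g h /= gh].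
  apply: uf_up (large g h eps eps0) => // k [sub lt].
  rewrite rho_mx_defect ?unitmx_mul ?pu // Rabs_pos_eq; last exact: rho_ge0.
  have [_ _ hk] := hp k; exact: Rle_lt_trans (hk g h sub).1 lt.
(* Once [7 * e k < 1 / 8], the separation exceeds [1 / 8], while equal classes are closer than
   [1 / 8] at some such stage. *)
apply: contrapT => ne; have e8 : (0 < 1 / 8)%Re by lra.
have [k [lt [sub ek]]] := uf_inhabited hU (uf_cap hU (gh _ e8) (large g h _ e8)).
move: lt; rewrite rho_mx_defect ?pu // Rabs_pos_eq; last exact: rho_ge0.
have [_ _ hk] := hp k; have ? := (hk g h sub).2 ne => ?; rlra.
Qed.

(** * Extensions with amenable quotient *)

Lemma quotient_countable (G : group) (H : G -> Prop) (hH : normal_subgroup G H) :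
  countable_group G -> countable_group (quotient_group hH).
Proof.
move=> [code inj]; exists (fun q => code (qrep q)) => q q' /inj e.
by rewrite -(qclass_rep q) -(qclass_rep q') e.
Qed.

Theorem mainTheorem16 (G : group) (H : G -> Prop) (hH : normal_subgroup G H) :
  countable_group G ->
  linear_sofic (subgroup_group hH) ->
  amenable (quotient_group hH) ->
  linear_sofic G.
Proof.
move=> cG sH aQ; have [_ [U [_ [_ [hU [npU _]]]]]] := sH.
apply: (approx_linear_sofic hU npU cG) => E e N e0.
(* The boundary of [F] has proportion at most [1 / q < e / 2]. *)
have [q hq] := INR_unbounded (2 / e)%Re.
have qp : (0 < INR q)%Re.
  by apply: Rlt_trans hq; apply: Rdiv_lt_0_compat; lra.
have [F [uF F0 hF]] :=
  folner_set [seq qclass H g : quotient_group hH | g <- E] q hU npU (quotient_countable hH cG) aQ.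
have [s s0 happ] := linear_sofic_approx [seq cocycle g x | g <- E, x <- F] sH.
have [t ht] := approx_amplify [seq cocycle g x | g <- E, x <- F] s0.
(* The choices go from [F] to [s], then [t], then [d], so that [t d <= e / 2]; the successor avoids
   division by zero. *)
pose d := (e / 2 / INR t.+1)%Re.
have tp : (0 < INR t.+1)%Re by apply/lt_0_INR/ltP.
have d0 : (0 < d)%Re by apply: Rdiv_lt_0_compat; lra.
have [n [f [n0 hf]]] := happ d d0.
have [m [phi [Nm m0 hphi]]] := ht N d n f n0 (Rlt_le _ _ d0) hf.
exists (size F * m)%N, (@induced G H hH F m phi); split.
- by rewrite (leq_trans Nm) // leq_pmull.
- by rewrite muln_gt0 F0.
have td : (INR t * d <= e / 2)%Re.
  have -> : (e / 2 = INR t.+1 * d)%Re by rewrite /d; field; lra.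
  by apply: Rmult_le_compat_r; [lra | rewrite S_INR; lra].
have td0 : (0 <= INR t * d)%Re by apply: Rmult_le_pos; [exact: pos_INR | lra].
have -> : e = (e / 2 + e / 2)%Re by lra.
apply: approx_induced => //; [lra | lra | | by apply: approx_weaken hphi; lra].
move=> g gE; have /leP/le_INR := hF _ (map_f _ gE).
rewrite -multE mult_INR; set c := INR (count _ _); set N' := INR (size F) => le.
have c0 : (0 <= c)%Re by exact: pos_INR.
have hq' : (2 < INR q * e)%Re.
  have := Rmult_lt_compat_r _ _ _ e0 hq; rewrite /Rdiv Rmult_assoc Rinv_l; lra.
have : (2 * c <= INR q * e * c)%Re by apply: Rmult_le_compat_r => //; lra.
have := Rmult_le_compat_l e _ _ (Rlt_le _ _ e0) le; lra.
Qed.
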